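(* Let $\{P_n\}_{n\ge0}$ be a classical monic orthogonal polynomial sequence, with $\Phi,\psi,C_n,D_n$ as in the context. Then for every $n\ge0$, $$\mathcal{C}(x;n)P_{n+1}''(x)+\mathcal{D}(x;n)P_{n+1}'(x)+\mathcal{E}(x;n)P_{n+1}(x)=0,$$ with $$\mathcal C(x;n)=\Phi(x),\qquad \mathcal D(x;n)=\Phi'(x)+C_0(x)=-\psi(x),\qquad \mathcal E(x;n)=-\Big[\sum_{\nu=0}^nD_\nu(x)+\tfrac12\big(C_{n+1}'(x)-C_0'(x)\big)\Big].$$
   Context: A form $u$ is a linear functional on the space of complex polynomials, with moments $(u)_n=\langle u,x^n\rangle$. It is regular, with monic orthogonal polynomial sequence (MOPS) $\{P_n\}_{n\ge0}$, if $P_n$ is monic of degree $n$ and $\langle u,P_nP_m\rangle=r_n\delta_{n,m}$ with all $r_n\neq0$. Forms are normalized: $(u)_0=1$. A MOPS satisfies $P_0=1$, $P_1=x-\beta_0$, $P_{n+2}=(x-\beta_{n+1})P_{n+1}-\gamma_{n+1}P_n$ ($n\ge0$), with $\beta_n\in\mathbb C$, $\gamma_{n+1}\in\mathbb C\setminus\{0\}$. The formal Stieltjes function of $u$ is $S(u)(z)=-\sum_{n\ge0}(u)_n z^{-n-1}$. The regular form $u$ (and its MOPS) is classical if there are polynomials $\Phi,C,D$, with $\Phi$ monic, such that, as formal series in $1/z$, $\Phi(z)S'(u)(z)=C(z)S(u)(z)+D(z)$, and moreover $\deg\Phi\le2$ and $\deg\psi=1$, where $\psi:=-\Phi'-C$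 (equivalently, $(\Phi u)'+\psi u=0$, where $\langle fu,p\rangle=\langle u,fp\rangle$ and $\langle u',p\rangle=-\langle u,p'\rangle$). Fix such polynomials. Define polynomials $C_n,D_n$ by $C_0=C$, $D_0=D$, $D_{-1}=0$, $\gamma_0=1$, and for $n\ge0$: $C_{n+1}(x)=-C_n(x)+2(x-\beta_n)D_n(x)$, $\gamma_{n+1}D_{n+1}(x)=-\Phi(x)+\gamma_nD_{n-1}(x)-(x-\beta_n)C_n(x)+(x-\beta_n)^2D_n(x)$. *)

(* Defs.v *)
From mathcomp Require Import all_boot all_order all_algebra.
From mathcomp Require Import reals complex.

Set Implicit Arguments.
Unset Strict Implicit.
Unset Printing Implicit Defensive.

Import GRing.Theory.
Local Open Scope ring_scope.

Section Forms.
Variable K : fieldType.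
Implicit Types (u : {scalar {poly K}}) (P : nat -> {poly K}).

Definition moment u (n : nat) : K := u 'X^n.

Definition normalized u := moment u 0%N = 1.

Definition is_MOPS u P :=
  (forall n, P n \is monic /\ size (P n) = n.+1) /\
  exists r : nat -> K,
    (forall n, r n != 0) /\ (forall n m, u (P n * P m) = r n *+ (n == m)).

(* [gamma 0] does not occur in the recurrence of the orthogonal polynomials;
   the convention gamma_0 = 1 serves the recurrence [CD_recurrence] below. *)
Definition recurrence_coefficients P (beta gamma : nat -> K) :=
  [/\ P 0%N = 1,
      P 1%N = 'X - (beta 0%N)%:P,
      forall n, P n.+2 = ('X - (beta n.+1)%:P) * P n.+1 - gamma n.+1 *: P n,
      gamma 0%N = 1
    & forall n, gamma n.+1 != 0].

(* A formal series in z and 1/z is given by its coefficients: [f k] is the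
   coefficient of z^k, for k of either sign.  All series below have only
   finitely many nonzero coefficients of positive index. *)
Definition fseries := int -> K.

Definition fseries_of_poly (p : {poly K}) : fseries :=
  fun k => if k is Posz n then p`_n else 0.

Definition fseries_add (f g : fseries) : fseries := fun k => f k + g k.

Definition fseries_mulp (p : {poly K}) (f : fseries) : fseries :=
  fun k => \sum_(i < size p) p`_i * f (k - i%:Z).

Definition fseries_deriv (f : fseries) : fseries :=
  fun k => (k + 1)%:~R * f (k + 1).

(* [Negz n] is the integer -n-1. *)
Definition stieltjes u : fseries :=
  fun k => if k is Negz n then - moment u n else 0.

Definition psi (Phi C : {poly K}) : {poly K} := - Phi^`() - C.

Definition classical_equation u (Phi C D : {poly K}) :=
  [/\ Phi \is monic,
      fseries_mulp Phi (fseries_deriv (stieltjes u))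
        =1 fseries_add (fseries_mulp C (stieltjes u)) (fseries_of_poly D),
      (size Phi <= 3)%N
    & size (psi Phi C) = 2%N].

(* The term D_{n-1}, with D_{-1} = 0. *)
Definition prevD (D : nat -> {poly K}) (n : nat) : {poly K} :=
  if n is m.+1 then D m else 0.

Definition CD_recurrence (beta gamma : nat -> K) (Phi C0 D0 : {poly K})
    (C D : nat -> {poly K}) :=
  [/\ C 0%N = C0,
      D 0%N = D0,
      forall n, C n.+1 = - C n + 2 *: (('X - (beta n)%:P) * D n)
    & forall n, gamma n.+1 *: D n.+1
        = - Phi + gamma n *: prevD D n - ('X - (beta n)%:P) * C n
          + ('X - (beta n)%:P) ^+ 2 * D n].

Definition calC (Phi : {poly K}) : {poly K} := Phi.

Definition calD (Phi : {poly K}) (C : nat -> {poly K}) : {poly K} :=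
  Phi^`() + C 0%N.

Definition calE (C D : nat -> {poly K}) (n : nat) : {poly K} :=
  - (\sum_(0 <= nu < n.+1) D nu + 2^-1 *: ((C n.+1)^`() - (C 0%N)^`())).

End Forms.

(* Main.v *)
(* The equation for the Stieltjes function says <u, Phi q' - psi q> = 0 for all
   q, so the operator L p = Phi p'' - psi p' satisfies
   <u, L p . q> = - <u, Phi p' q'>.  It is thus symmetric, and as it does not
   raise degrees, L P_n = lambda_n P_n.  Comparing the coefficients of x^(n-1)
   and x^(n-2) in this equation gives relations for beta_n and gamma_n by which
   the recurrence of C_n and D_n is solved explicitly: D_n is the constant
   (2n-1) Phi_2 - psi_1, and C_n is affine with slope (2n-2) Phi_2 - psi_1.
   Hence calE(.; n) is the constant -lambda_(n+1). *)
Require Import Defs.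
From mathcomp Require Import all_boot all_order all_algebra.
From mathcomp Require Import reals complex.
From mathcomp Require Import ring.

Set Implicit Arguments.
Unset Strict Implicit.
Unset Printing Implicit Defensive.

Import GRing.Theory.
Local Open Scope ring_scope.

(** * Orthogonality to lower degrees and nondegeneracy of the form *)

Section OrthogonalPolynomials.
Variables (K : fieldType) (u : {scalar {poly K}}) (P : nat -> {poly K}).
Hypothesis hP : is_MOPS u P.

Lemma MOPS_size n : size (P n) = n.+1.
Proof. by case: hP => + _ => /(_ n) []. Qed.

Lemma MOPS_coef_lead n : (P n)`_n = 1.
Proof.
by case: hP => + _ => /(_ n) [/monicP + szP]; rewrite /lead_coef szP.
Qed.

Lemma size_sub_lead n (q : {poly K}) :
  (size q <= n.+1)%N -> (size (q - q`_n *: P n)%R <= n)%N.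
Proof.
move=> sq; apply/leq_sizeP => j; rewrite leq_eqVlt => /orP[/eqP<-|ltnj].
  by rewrite coefB coefZ MOPS_coef_lead mulr1 subrr.
rewrite coefB coefZ (nth_default 0 (leq_trans sq ltnj)).
by rewrite [(P n)`_j]nth_default ?MOPS_size // mulr0 subr0.
Qed.

Lemma MOPS_orth_lower m n (q : {poly K}) :
  (size q <= m)%N -> (m <= n)%N -> u (P n * q) = 0.
Proof.
elim: m q => [|m IHm] q sq le_mn.
  by move: sq; rewrite leqn0 size_poly_eq0 => /eqP->; rewrite mulr0 linear0.
have [_ [r [_ orthP]]] := hP.
rewrite -[q](subrK (q`_m *: P m)) mulrDr linearD /=.
rewrite IHm ?(ltnW le_mn) ?size_sub_lead // add0r -scalerAr linearZ /= orthP.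
by rewrite gtn_eqF // mulr0n mulr0.
Qed.

(** Pairing with [P n] isolates the top coefficient of [q], which vanishes as [r n] is nonzero; the
    degree then drops. *)
Lemma MOPS_nondegenerate (q : {poly K}) n : (size q <= n)%N ->
  (forall m, (m < n)%N -> u (q * P m) = 0) -> q = 0.
Proof.
have [_ [r [r_neq0 orthP]]] := hP.
elim: n q => [|n IHn] q sq q_orth.
  by apply/eqP; rewrite -size_poly_eq0 -leqn0.
suff qn0 : q`_n = 0.
  apply: IHn => [|m lt_mn]; last by rewrite q_orth // ltnW.
  by have := size_sub_lead sq; rewrite qn0 scale0r subr0.
have := q_orth n (ltnSn n); rewrite -[in u _](subrK (q`_n *: P n) q).
rewrite mulrDl linearD /= mulrC (MOPS_orth_lower (size_sub_lead sq)) // add0r.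
rewrite -scalerAl linearZ /= orthP eqxx mulr1n => /eqP.
by rewrite mulf_eq0 (negbTE (r_neq0 n)) orbF => /eqP.
Qed.

End OrthogonalPolynomials.

Lemma poly_size_le3 (K : fieldType) (F : {poly K}) : (size F <= 3)%N ->
  F = (F`_0)%:P + (F`_1)%:P * 'X + (F`_2)%:P * 'X^2.
Proof.
move=> sF; apply/polyP => -[|[|[|k]]];
  rewrite !coefD coefC coefMX coefMXn ?coefC /=.
- by rewrite !addr0.
- by rewrite addr0 add0r.
- by rewrite !add0r.
- by rewrite nth_default ?addr0 // (leq_trans sF).
Qed.

(** * From the Stieltjes equation to the functional equation of the form *)

Section ClassicalForm.
Variables (K : fieldType) (u : {scalar {poly K}}) (Phi C D : {poly K}).
Hypothesis hcl : classical_equation u Phi C D.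

Lemma stieltjes_ge0 n : stieltjes u (Posz n) = 0.
Proof. by []. Qed.

Lemma NegzB m i : Negz m - i%:Z = Negz (m + i).
Proof. by rewrite !NegzE -opprD -PoszD addSn. Qed.

Lemma fseries_mulp_widen N (p : {poly K}) f k : (size p <= N)%N ->
  fseries_mulp p f k = \sum_(i < N) p`_i * f (k - i%:Z).
Proof.
move=> le_pN; rewrite /fseries_mulp.
rewrite (big_ord_widen N (fun i => p`_i * f (k - i%:Z)) le_pN).
rewrite big_mkcond; apply: eq_bigr => i _.
by case: ltnP => // le_pi; rewrite nth_default ?mul0r.
Qed.

(** In terms of the dual derivative <u', p> = -<u, p'>, this is S(u)' = S(u'). *)
Lemma deriv_stieltjes_Negz m :
  fseries_deriv (stieltjes u) (Negz m) = u ('X^m)^`().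
Proof.
rewrite /fseries_deriv derivXn; case: m => [|m].
  by rewrite mulr0n linear0 mul0r.
have -> : Negz m.+1 + 1 = Negz m by rewrite !NegzE -addn1 PoszD opprD subrK.
by rewrite linearMn /= NegzE mulNr mulrN opprK -[RHS]mulr_natl.
Qed.

(** This is the coefficient of z^(-m-1) in the Stieltjes equation, to which the polynomial [D] does
    not contribute. *)
Lemma form_pearson_Xn m : u ((Phi * 'X^m)^`() + C * 'X^m) = 0.
Proof.
have [_ /(_ (Negz m)) + _ _] := hcl.
rewrite /fseries_add /fseries_mulp addr0 => eqm.
rewrite linearD /= -{1}[Phi]coefK -{1}[C]coefK !poly_def.
rewrite !mulr_suml raddf_sum !linear_sum /=.
under eq_bigr => i _.
  rewrite -scalerAl -exprD linearZ /= linearZ /= addnC -deriv_stieltjes_Negz.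
  rewrite -NegzB; over.
rewrite eqm -big_split big1 //= => i _.
by rewrite NegzB -scalerAl -exprD linearZ /= /moment addnC mulrN addNr.
Qed.

(** The functional equation (Phi u)' + psi u = 0 tested on [q], by linearity from monomials. *)
Lemma form_pearson q : u (Phi * q^`() - psi Phi C * q) = 0.
Proof.
rewrite -[q]coefK poly_def (linear_sum (@deriv K)) !mulr_sumr -sumrB.
rewrite linear_sum big1 // => i _.
rewrite /= derivZ -!scalerAr -scalerBr linearZ /= -[RHS](mulr0 q`_i).
congr (_ * _); rewrite -(form_pearson_Xn i) derivM /psi; congr (u _); ring.
Qed.

Lemma size_classicalC : (size C <= 2)%N.
Proof.
have [_ _ sPhi spsi] := hcl.
have -> : C = - psi Phi C - Phi^`() by rewrite /psi; ring.
rewrite (leq_trans (size_polyD _ _)) // geq_max !size_polyN spsi leqnn.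
by rewrite (leq_trans (size_poly _ _)) // -subn1 leq_subLR.
Qed.

Hypothesis hu : normalized u.

(** The nonnegative powers of z: S starts at z^(-1) and S' at z^(-2), so the degree bounds on [Phi]
    and [C] leave only z^0, where (u)_0 = 1 enters. *)
Lemma classicalD_const : D = (Phi`_2 + C`_1)%:P.
Proof.
have [_ eqS sPhi _] := hcl; have sC := size_classicalC.
apply/polyP => n; have := eqS (Posz n).
rewrite /fseries_add (fseries_mulp_widen _ _ sPhi) (fseries_mulp_widen _ _ sC).
rewrite !big_ord_recr !big_ord0 /= !add0r coefC.
have S'_ge0 k : fseries_deriv (stieltjes u) (Posz k) = 0.
  by rewrite /fseries_deriv -PoszD stieltjes_ge0 mulr0.
case: n => [|[|n]] /=.
- rewrite (_ : 0%Z - 0%Z = 0%Z) // (_ : 0%Z - 1%Z = Negz 0) //.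
  rewrite (_ : 0%Z - 2%Z = Negz 1) // S'_ge0 !deriv_stieltjes_Negz.
  rewrite derivX derivC linear0 -[u 1]/(moment u 0) hu => eq0.
  have -> : Phi`_2 = - C`_1 + D`_0 by ring: eq0.
  ring.
- rewrite (_ : 1%Z - 0%Z = 1%Z) // (_ : 1%Z - 1%Z = 0%Z) //.
  rewrite (_ : 1%Z - 2%Z = Negz 0) // !S'_ge0 deriv_stieltjes_Negz.
  by rewrite derivC linear0 !mulr0 !addr0 add0r => <-.
- have -> : n.+2%:Z - 1%Z = n.+1%:Z by rewrite -addn1 PoszD addrK.
  have -> : n.+2%:Z - 2%Z = n%:Z by rewrite -addn2 PoszD addrK.
  rewrite subr0.
  by rewrite !S'_ge0 !mulr0 !addr0 add0r => <-.
Qed.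

End ClassicalForm.

(** * The second-order operator and its eigenpolynomials *)

Section Eigenfunctions.
Variables (K : fieldType) (u : {scalar {poly K}}) (Phi C D : {poly K}).
Hypothesis hcl : classical_equation u Phi C D.

Let L (p : {poly K}) := Phi * p^`()^`() - psi Phi C * p^`().

Lemma bochner_symmetric p q : u (L p * q) = u (p * L q).
Proof.
(* Integration by parts: the functional equation tested on f' g. *)
have L_parts f g : u (L f * g) = - u (Phi * f^`() * g^`()).
  apply/eqP; rewrite -addr_eq0 -linearD.
  rewrite -[X in _ == X](form_pearson hcl (f^`() * g)).
  by apply/eqP; congr (u _); rewrite derivM /L; ring.
by rewrite L_parts [p * _]mulrC L_parts; congr (- u _); ring.
Qed.

Let s := (psi Phi C)`_1.
Let t := (psi Phi C)`_0.

Lemma coef_bochner p k : (L p)`_k =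
  k.+2%:R * k.+1%:R * Phi`_0 * p`_k.+2
  + k.+1%:R * (k%:R * Phi`_1 - t) * p`_k.+1
  + k%:R * ((k%:R - 1) * Phi`_2 - s) * p`_k.
Proof.
have [_ _ sPhi spsi] := hcl.
have psiE : psi Phi C = t%:P + s%:P * 'X.
  rewrite {1}[psi _ _]poly_size_le3 ?spsi // [_`_2]nth_default ?spsi //.
  by rewrite polyC0 mul0r addr0.
have -> : L p = (Phi`_0)%:P * p^`()^`() + (Phi`_1)%:P * (p^`()^`() * 'X)
    + (Phi`_2)%:P * (p^`()^`() * 'X^2) - (t%:P * p^`() + s%:P * (p^`() * 'X)).
  by rewrite /L psiE {1}(poly_size_le3 sPhi); ring.
rewrite coefB !coefD !coefCM !coefMX !coefMXn !coef_deriv.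
by case: k => [|[|k]] /=; rewrite ?subn0 ?subn2 ?coef_deriv /=; ring.
Qed.

Lemma size_bochner (p : {poly K}) n : (size p <= n)%N -> (size (L p) <= n)%N.
Proof.
move/leq_sizeP => p0; apply/leq_sizeP => j le_nj.
by rewrite coef_bochner !p0 ?leqW // !mulr0 !addr0.
Qed.

Variable P : nat -> {poly K}.
Hypothesis hP : is_MOPS u P.

(** The coefficient of x^n in L x^n. *)
Definition eigenvalue n : K := n%:R * ((n%:R - 1) * Phi`_2 - s).

(** The difference of the two sides has degree below n. By symmetry it is orthogonal to each [P m]
    with m < n, since L (P m) has degree at most m; nondegeneracy makes it zero. *)
Lemma bochner_MOPS n : L (P n) = eigenvalue n *: P n.
Proof.
apply/eqP; rewrite -subr_eq0; apply/eqP.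
apply: (MOPS_nondegenerate hP (n := n)) => [|m lt_mn]; last first.
  rewrite mulrBl linearB /= bochner_symmetric -scalerAl linearZ /=.
  rewrite (MOPS_orth_lower hP _ lt_mn) ?size_bochner ?(MOPS_size hP) //.
  by rewrite (MOPS_orth_lower hP _ lt_mn) ?(MOPS_size hP) // mulr0 subr0.
apply/leq_sizeP => j le_nj; rewrite coefB coefZ coef_bochner.
rewrite [(P n)`_j.+2]nth_default ?(MOPS_size hP) ?ltnS ?(leqW le_nj) //.
rewrite [(P n)`_j.+1]nth_default ?(MOPS_size hP) ?ltnS // !mulr0 !add0r.
move: le_nj; rewrite leq_eqVlt => /orP[/eqP<-|lt_nj].
  by rewrite /eigenvalue; ring.
by rewrite [(P n)`_j]nth_default ?(MOPS_size hP) // !mulr0 subrr.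
Qed.

(* [subcoef n] and [subsubcoef n] are the coefficients of x^(n-1) and x^(n-2) in
   [P n], or 0 when the exponent is negative. *)
Definition subcoef n := ('X * P n)`_n.
Definition subsubcoef n := ('X * ('X * P n))`_n.

Lemma subcoef_eigen n :
  subcoef n * (s - 2 * (n%:R - 1) * Phi`_2)
  = n%:R * (t - (n%:R - 1) * Phi`_1).
Proof.
rewrite /subcoef coefXM; case: n => [|n] /=; first by rewrite !mul0r.
have /(congr1 (fun p : {poly K} => p`_n)) := bochner_MOPS n.+1.
rewrite coef_bochner coefZ /eigenvalue (MOPS_coef_lead hP).
rewrite [(P n.+1)`_n.+2]nth_default ?(MOPS_size hP) // => eq_n.
apply/eqP; rewrite -subr_eq0; move/eqP: eq_n; rewrite -subr_eq0 => /eqP eq_n.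
by apply/eqP; rewrite -[RHS]eq_n; ring.
Qed.

Lemma subsubcoef_eigen n :
  2 * subsubcoef n * ((2 * n%:R - 3) * Phi`_2 - s)
  = subcoef n * (n%:R - 1) * ((n%:R - 2) * Phi`_1 - t)
    + n%:R * (n%:R - 1) * Phi`_0.
Proof.
rewrite /subcoef /subsubcoef !coefXM.
case: n => [|[|n]] /=; rewrite ?coefXM /=; [ring | ring |].
have /(congr1 (fun p : {poly K} => p`_n)) := bochner_MOPS n.+2.
rewrite coef_bochner coefZ /eigenvalue (MOPS_coef_lead hP) => eq_n.
apply/eqP; rewrite -subr_eq0; move/eqP: eq_n; rewrite -subr_eq0 => /eqP eq_n.
by apply/eqP; rewrite -[RHS]oppr0 -[in RHS]eq_n; ring.
Qed.

(** * Explicit solution of the recurrence for C_n and D_n *)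

Hypothesis hu : normalized u.
Hypothesis two_neq0 : 2%:R != 0 :> K.
Variables (beta gamma : nat -> K) (CC DD : nat -> {poly K}).
Hypothesis hrec : recurrence_coefficients P beta gamma.
Hypothesis hCD : CD_recurrence beta gamma Phi C D CC DD.

(** The value 0 at n = 0, in place of the convention gamma_0 = 1, makes [subsubcoefS] hold from n =
    0 on. *)
Let gamma' n := if n is 0 then 0 else gamma n.

Lemma three_term n :
  P n.+1 = ('X - (beta n)%:P) * P n - gamma' n *: prevD P n.
Proof.
case: hrec => P0 P1 PS _ _; case: n => [|n] /=; last exact: PS.
by rewrite P1 P0 mulr1 scale0r subr0.
Qed.

Lemma subcoefS n : subcoef n.+1 = subcoef n - beta n.
Proof.
rewrite /subcoef coefXM /= three_term mulrBl !coefB coefCM coefZ.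
rewrite (MOPS_coef_lead hP) [(prevD P n)`_n]nth_default ?mulr0 ?mulr1 ?subr0 //.
by case: n => [|n] /=; rewrite ?size_poly0 // (MOPS_size hP).
Qed.

Lemma subsubcoefS n :
  subsubcoef n.+1 = subsubcoef n - beta n * subcoef n - gamma' n.
Proof.
rewrite /subsubcoef /subcoef coefXM /= three_term.
have -> : 'X * (('X - (beta n)%:P) * P n - gamma' n *: prevD P n) =
    'X * ('X * P n) - (beta n)%:P * ('X * P n)
    - (gamma' n)%:P * ('X * prevD P n).
  by rewrite -mul_polyC; ring.
rewrite !coefB !coefCM; congr (_ - _).
by case: n => [|n]; rewrite ?mul0r //= coefXM /= (MOPS_coef_lead hP) mulr1.
Qed.

Let d n : K := (2 * n%:R - 1) * Phi`_2 - s.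
(** The constant term of C_n; here [subcoef n] is -(beta_0 + ... + beta_(n-1)). *)
Let c0 n : K := (2 * n%:R - 1) * Phi`_1 - t - 2 * Phi`_2 * subcoef n.
Let c1 n : K := (2 * n%:R - 2) * Phi`_2 - s.

Let subcoef_eigen0 n : subcoef n * (s - 2 * (n%:R - 1) * Phi`_2)
  - n%:R * (t - (n%:R - 1) * Phi`_1) = 0.
Proof. by rewrite subcoef_eigen subrr. Qed.

Let subsubcoef_eigen0 n : 2 * subsubcoef n * ((2 * n%:R - 3) * Phi`_2 - s)
  - (subcoef n * (n%:R - 1) * ((n%:R - 2) * Phi`_1 - t)
     + n%:R * (n%:R - 1) * Phi`_0) = 0.
Proof. by rewrite subsubcoef_eigen subrr. Qed.

(** Makes the coefficient of x in gamma_(n+1) D_(n+1) vanish; it is the difference of the [subcoef]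
    relations at n+1 and n. *)
Lemma CD_linear_coef n :
  (2 * d n - c1 n) * beta n + Phi`_1 + c0 n = 0.
Proof.
have -> : beta n = subcoef n - subcoef n.+1 by rewrite subcoefS; ring.
rewrite -[RHS](subr0 0) -[X in _ = X - _](subcoef_eigen0 n.+1).
by rewrite -[X in _ = _ - X](subcoef_eigen0 n) /d /c0 /c1; ring.
Qed.

(** The constant term of the recurrence for D_(n+1), with d n - 2 Phi_2 standing for D_(n-1). *)
Lemma CD_constant_coef n :
  gamma n.+1 * d n.+1 = - Phi`_0 + gamma' n * (d n - 2 * Phi`_2)
    + beta n * c0 n + beta n ^+ 2 * d n.
Proof.
have betaE k : beta k = subcoef k - subcoef k.+1 by rewrite subcoefS; ring.
have gammaE k : gamma' k =
    subsubcoef k - subsubcoef k.+1 - beta k * subcoef k.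
  by rewrite subsubcoefS; ring.
rewrite -[gamma n.+1]/(gamma' n.+1) !gammaE !betaE.
(* Doubling matches the factor 2 of [subsubcoef] in its relation. *)
apply: (mulfI two_neq0); apply/eqP; rewrite -subr_eq0; apply/eqP.
(* The multipliers below express the difference of both sides in the ideal of
   the coefficient relations; no division by s - 2 (n-1) Phi_2 is needed. *)
pose B k := subcoef_eigen0 k; pose A k := subsubcoef_eigen0 k.
have := congr1 (fun x => 2 * x) (A n.+1).
move/(congr2 (fun x y => y - x) (A n.+2)).
move/(congr2 (fun x y => y - x) (A n)).
move/(congr2 (fun x y => y - subcoef n.+2 * x) (B n.+1)).
move/(congr2 (fun x y => y - subcoef n.+1 * x) (B n.+2)).
move/(congr2 (fun x y => y + (4 * subcoef n.+1 - subcoef n) * x) (B n.+1)).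
move/(congr2 (fun x y => y - subcoef n.+1 * x) (B n)).
by rewrite !mulr0 ?subr0 ?addr0 => eq0; rewrite -[RHS]eq0 /d /c0; ring.
Qed.

Lemma classicalC_coef : C = (c0 0)%:P + c1 0 *: 'X.
Proof.
have sC := size_classicalC hcl.
apply/polyP => k; rewrite coefD coefC coefZ coefX /c0 /c1 /t /s /psi.
rewrite !coefB !coefN !coef_deriv /subcoef coefXM /=.
case: k => [|[|k]] /=; [ring | ring |].
by rewrite nth_default ?(leq_trans sC) // mulr0 addr0.
Qed.

(* The third component treats gamma_n D_(n-1) uniformly: the explicit D_(n-1),
   d n - 2 Phi_2, does not vanish at n = 0, but gamma' 0 = 0. *)
Lemma CD_explicit n :
  [/\ CC n = (c0 n)%:P + c1 n *: 'X, DD n = (d n)%:P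
    & gamma n *: prevD DD n = (gamma' n * (d n - 2 * Phi`_2))%:P].
Proof.
have [CC0 DD0 CCS DDS] := hCD; have [_ _ sPhi _] := hcl.
have [_ _ _ _ gamma_neq0] := hrec.
elim: n => [|n [CCn DDn prevn]].
  split; first by rewrite CC0 classicalC_coef.
    rewrite DD0 (classicalD_const hcl hu) classicalC_coef.
    rewrite coefD coefC coefZ coefX /c1 /d /=; congr (_%:P); ring.
  by rewrite /= scaler0 mul0r.
have := CD_linear_coef n => lin.
have CCn1 : CC n.+1 = (c0 n.+1)%:P + c1 n.+1 *: 'X.
  rewrite CCS CCn DDn.
  (* The difference of the two sides is twice [CD_linear_coef]. *)
  have -> : c0 n.+1 = - c0 n - 2 * d n * beta n.
    apply/eqP; rewrite -subr_eq0; apply/eqP.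
    have betaE : beta n = subcoef n - subcoef n.+1 by rewrite subcoefS; ring.
    by rewrite -[RHS](mulr0 2) -[X in _ = _ * X]lin betaE /d /c0 /c1; ring.
  have -> : c1 n.+1 = - c1 n + 2 * d n by rewrite /c1 /d; ring.
  by rewrite -!mul_polyC; ring.
have DDn1 : DD n.+1 = (d n.+1)%:P.
  (* On the right the x^2 terms cancel because c1 n = d n - Phi_2, and the x terms by
     [CD_linear_coef]. *)
  apply: (scalerI (gamma_neq0 n)); rewrite DDS prevn CCn DDn.
  rewrite -[in RHS]mul_polyC -polyCM CD_constant_coef.
  have -> : c0 n = - Phi`_1 - (2 * d n - c1 n) * beta n.
    by rewrite -[LHS]subr0 -[X in _ - X = _]lin; ring.
  rewrite {1}(poly_size_le3 sPhi) -!mul_polyC.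
  have -> : c1 n = d n - Phi`_2 by rewrite /c1 /d; ring.
  ring.
split=> //=; rewrite DDn -mul_polyC -polyCM; congr (_ * _)%:P.
by rewrite /d; ring.
Qed.

(** The D_k sum as an arithmetic progression to (n+1)((n-1) Phi_2 - s), and half the difference of
    slopes of C_(n+1) and C_0 adds (n+1) Phi_2. *)
Lemma calE_eigenvalue n : calE CC DD n = - (eigenvalue n.+1)%:P.
Proof.
rewrite /calE; congr (- _).
have [-> _ _] := CD_explicit n.+1; have [-> _ _] := CD_explicit 0.
have -> : \sum_(0 <= k < n.+1) DD k
    = (n.+1%:R * ((n%:R - 1) * Phi`_2 - s))%:P.
  elim: n => [|n IHn]; rewrite ?big_nat1 ?[LHS]big_nat_recr //= ?IHn.
    by have [_ -> _] := CD_explicit 0; congr _%:P; rewrite /d; ring.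
  have [_ -> _] := CD_explicit n.+1; rewrite -polyCD; congr _%:P.
  by rewrite /d; ring.
rewrite !derivD !derivZ !derivC !derivX !add0r -scalerBl scalerA alg_polyC.
rewrite -polyCD; congr _%:P; rewrite /c1 /eigenvalue.
apply: (mulfI two_neq0); rewrite mulrDr mulrA mulVKf //.
ring.
Qed.

Lemma second_order_ode n :
  calC Phi * (P n)^`()^`() + calD Phi CC * (P n)^`() - eigenvalue n *: P n = 0.
Proof.
have [CC0 _ _ _] := hCD.
by rewrite -bochner_MOPS /calC /calD CC0 /L /psi; ring.
Qed.

End Eigenfunctions.

Theorem corollary3 (R : realType) (u : {scalar {poly R[i]}})
    (P : nat -> {poly R[i]}) (beta gamma : nat -> R[i])
    (Phi C0 D0 : {poly R[i]}) (C D : nat -> {poly R[i]})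
    (hu : normalized u)
    (hP : is_MOPS u P)
    (hrec : recurrence_coefficients P beta gamma)
    (hcl : classical_equation u Phi C0 D0)
    (hCD : CD_recurrence beta gamma Phi C0 D0 C D) :
  calD Phi C = - psi Phi C0 /\
  forall n : nat,
    calC Phi * (P n.+1)^`()^`() + calD Phi C * (P n.+1)^`()
      + calE C D n * P n.+1 = 0.
Proof.
split=> [|n]; first by case: hCD => CC0 _ _ _; rewrite /calD CC0 /psi; ring.
rewrite (calE_eigenvalue hcl hP hu _ hrec hCD) ?Num.Theory.pnatr_eq0 //.
by rewrite mulNr mul_polyC (second_order_ode hcl hP hCD).
Qed.
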